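(* Let $X_1$ and $X_2$ be two strong fuzzy incidence graphs. Then the tensor product $X_1\diamond X_2$ is a strong fuzzy incidence graph.
   Context: Fuzzy incidence graphs. All graphs are finite, simple and undirected; $\wedge$ denotes minimum. A fuzzy incidence graph (FIG) $X=(V,E,I,\varepsilon,\rho,\eta)$ consists of a nonempty finite vertex set $V$, a set $E$ of edges $xy=yx$ ($x\neq y$ in $V$), a set $I$ of (incidence) pairs $(x,xy)$ with $xy\in E$ and $x$ an endpoint of $xy$, and functions $\varepsilon:V\to(0,1]$, $\rho:E\to(0,1]$, $\eta:I\to(0,1]$ with $\rho(xy)\le\varepsilon(x)\wedge\varepsilon(y)$ for all $xy\in E$ and $\eta(x,xy)\le\varepsilon(x)\wedge\rho(xy)$ for all $(x,xy)\in I$ (vertices, edges, pairs of weight $0$ are regarded as absent). The number $\eta(x,xy)$ is the weight of the pair $(x,xy)$. Strong pairs. For $(a,ab)\in I$, an incidence path from $a$ to $ab$ in $X\setminus(a,ab)$ is a sequence $x_0=a,(x_0,x_0x_1),x_0x_1,(x_1,x_0x_1),x_1,\dots,x_k=b,(b,ab),ab$ with $k\ge2$, the vertices $x_0,\dots,x_k$ distinct, and all listed edges in $E$ and pairs in $I$; its incidence strength is the minimum weight of its pairs. $ICONN_{X\setminus(a,ab)}(a,ab)$ is the maximum incidence strength over all such paths ($0$ if there are none). The pair $(a,ab)$ is strong if $\eta(a,ab)\ge ICONN_{X\setminus(a,ab)}(a,ab)$. A strong fuzzy incidence graph (SFIG) is a FIG all of whose pairs are strong. Tensor product. For FIGs $X_i=(V_i,E_i,I_i,\varepsilon_i,\rho_i,\eta_i)$,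 $i=1,2$, the tensor product $X_1\diamond X_2=(V,E,I,\varepsilon,\rho,\eta)$ has $V=V_1\times V_2$; $E=\{(a_1,b_1)(a_2,b_2): a_1a_2\in E_1\text{ and }b_1b_2\in E_2\}$; $I$ is the set of pairs $((a_1,b_1),(a_1,b_1)(a_2,b_2))$ with $(a_1,a_1a_2),(a_2,a_1a_2)\in I_1$ and $(b_1,b_1b_2),(b_2,b_1b_2)\in I_2$; $\varepsilon(a,b)=\varepsilon_1(a)\wedge\varepsilon_2(b)$; $\rho((a_1,b_1)(a_2,b_2))=\rho_1(a_1a_2)\wedge\rho_2(b_1b_2)$; $\eta((a_1,b_1),(a_1,b_1)(a_2,b_2))=\eta_1(a_1,a_1a_2)\wedge\eta_2(b_1,b_1b_2)$. *)

(* Defs.v *)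
From HB Require Import structures.
From mathcomp Require Import all_boot all_order all_algebra.
From mathcomp Require Import reals.

Set Implicit Arguments.
Unset Strict Implicit.
Unset Printing Implicit Defensive.

Import Order.TTheory GRing.Theory Num.Theory.
Local Open Scope ring_scope.

(* The edge xy = yx is the two-element set [set x; y], and the incidence pair
   (x, xy) is (x, [set x; y]).  The weight functions are total; their values
   outside of the edges (resp. the pairs) are never used. *)
Record fig_data (R : realType) (V : finType) := FigData {
  edges : {set {set V}};
  pairs : {set V * {set V}};
  vweight : V -> R;
  eweight : {set V} -> R;
  pweight : V * {set V} -> R
}.

Definition is_fig (R : realType) (V : finType) (X : fig_data R V) : Prop :=
  (0 < #|V|)%N /\
  (forall e, e \in edges X -> exists x y, x != y /\ e = [set x; y]) /\
  (forall x e, (x, e) \in pairs X -> e \in edges X /\ x \in e) /\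
  (forall x, 0 < vweight X x <= 1) /\
  (forall e, e \in edges X -> 0 < eweight X e <= 1) /\
  (forall q, q \in pairs X -> 0 < pweight X q <= 1) /\
  (forall x y, [set x; y] \in edges X ->
     eweight X [set x; y] <= Num.min (vweight X x) (vweight X y)) /\
  (forall x e, (x, e) \in pairs X ->
     pweight X (x, e) <= Num.min (vweight X x) (eweight X e)).

Definition inc_step (R : realType) (V : finType) (X : fig_data R V) : rel V :=
  fun x y => [&& [set x; y] \in edges X,
                 (x, [set x; y]) \in pairs X & (y, [set x; y]) \in pairs X].

(* An incidence path from a to ab, with vertices x_0 = a, x_1, ..., x_k, is
   given by p = [:: x_1; ...; x_k].  Since the vertices are distinct and
   k >= 2, it never uses the pair (a, ab), so it lies in X \ (a, ab). *)
Definition inc_path (R : realType) (V : finType) (X : fig_data R V)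
    (a b : V) (p : seq V) : bool :=
  [&& (2 <= size p)%N, path (inc_step X) a p, uniq (a :: p), last a p == b,
      [set a; b] \in edges X & (b, [set a; b]) \in pairs X].

(* The pairs of the path other than the last one, (b, ab). *)
Definition step_pairs (V : finType) (a : V) (p : seq V) : seq (V * {set V}) :=
  flatten (pairmap (fun x y => [:: (x, [set x; y]); (y, [set x; y])]) a p).

Definition inc_strength (R : realType) (V : finType) (X : fig_data R V)
    (a b : V) (p : seq V) : R :=
  \big[Num.min/pweight X (b, [set a; b])]_(q <- step_pairs a p) pweight X q.

(* ICONN_{X \ (a, ab)}(a, ab).  As the vertices of a path are distinct, all
   paths have length at most #|V|. *)
Definition iconn (R : realType) (V : finType) (X : fig_data R V)
    (a b : V) : R :=
  \big[Num.max/0]_(p : #|V|.-bseq V | inc_path X a b p) inc_strength X a b p.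

Definition strong_pair (R : realType) (V : finType) (X : fig_data R V)
    (a b : V) : Prop :=
  iconn X a b <= pweight X (a, [set a; b]).

Definition is_sfig (R : realType) (V : finType) (X : fig_data R V) : Prop :=
  is_fig X /\
  (forall a b, (a, [set a; b]) \in pairs X -> strong_pair X a b).

(* For e = [set (a1, b1); (a2, b2)] the images of e under the projections are
   the edges a1a2 and b1b2. *)
Definition tensor (R : realType) (V1 V2 : finType)
    (X1 : fig_data R V1) (X2 : fig_data R V2) : fig_data R (V1 * V2)%type :=
  {| edges := [set [set u; v] | u in [set: V1 * V2], v in [set: V1 * V2] &
                ([set u.1; v.1] \in edges X1) &&
                ([set u.2; v.2] \in edges X2)];
     pairs := [set (u, [set u; v]) | u in [set: V1 * V2], v in [set: V1 * V2] &
                [&& (u.1, [set u.1; v.1]) \in pairs X1,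
                    (v.1, [set u.1; v.1]) \in pairs X1,
                    (u.2, [set u.2; v.2]) \in pairs X2 &
                    (v.2, [set u.2; v.2]) \in pairs X2]];
     vweight := fun u => Num.min (vweight X1 u.1) (vweight X2 u.2);
     eweight := fun e => Num.min (eweight X1 [set w.1 | w in e])
                                 (eweight X2 [set w.2 | w in e]);
     pweight := fun q =>
       Num.min (pweight X1 (q.1.1, [set w.1 | w in q.2]))
               (pweight X2 (q.1.2, [set w.2 | w in q.2])) |}.

(* Main.v *)
Require Import Defs.
From mathcomp Require Import all_boot all_order all_algebra.
From mathcomp Require Import reals.

(** If a path of the tensor product were stronger than the pair (u, uv), whose
weight is, say, that of the first component (a, ab), then projecting it to X1
gives a walk from a to b whose pairs are all heavier than (a, ab).  Such a walk
avoids the edge ab, so removing its loops leaves an incidence path of length at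
least 2 witnessing that (a, ab) is not strong. *)

Set Implicit Arguments.
Unset Strict Implicit.
Unset Printing Implicit Defensive.

Import Order.TTheory GRing.Theory Num.Theory.
Local Open Scope ring_scope.

Section Pair.
Variable T : finType.
Implicit Types x y z : T.

Lemma set2_injr x y z : [set x; y] = [set x; z] -> y = z.
Proof.
move=> e.
have: y \in [set x; z] by rewrite -e set22.
have: z \in [set x; y] by rewrite e set22.
by rewrite !inE => /orP[]/eqP-> // /orP[]/eqP->.
Qed.

Lemma set2_inj x y x' y' : [set x; y] = [set x'; y'] ->
  (x = x' /\ y = y') \/ (x = y' /\ y = x').
Proof.
move=> e; have: x \in [set x'; y'] by rewrite -e set21.
rewrite !inE => /orP[]/eqP xE.
  by left; split=> //; apply: (@set2_injr x); rewrite {2}xE.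
by right; split=> //; apply: (@set2_injr x); rewrite e setUC xE.
Qed.

Lemma imset_set2 (T' : finType) (f : T -> T') x y :
  [set f w | w in [set x; y]] = [set f x; f y].
Proof. by rewrite imsetU1 imset_set1. Qed.

End Pair.

Section Strength.
Variables (R : realType) (V : finType) (X : fig_data R V).

Lemma fig_edge_neq x y : is_fig X -> [set x; y] \in edges X -> x != y.
Proof.
case=> _ [edgeP _] /edgeP[x' [y' [neq /set2_inj[[-> ->]|[-> ->]]]]] //.
by rewrite eq_sym.
Qed.

(** The strict bound rules out a step along ab when [m] is the weight of (a, ab). *)
Definition heavier (m : R) : rel V := fun x y =>
  (m < pweight X (x, [set x; y])) && (m < pweight X (y, [set x; y])).

Definition heavy_step (m : R) : rel V :=
  fun x y => inc_step X x y && heavier m x y.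

(** The minimum starts from the weight of (b, ab), the closing pair of the incidence path, which
    yields the first conjunct; the other pairs come two per step. *)
Lemma lt_inc_strength m a b p :
  (m < inc_strength X a b p) =
  (m < pweight X (b, [set a; b])) && path (heavier m) a p.
Proof.
rewrite /inc_strength; move: (pweight X (b, _)) => w.
elim: p a => [|y p IHp] a; first by rewrite big_nil andbT.
rewrite /step_pairs /= !big_cons !lt_min IHp /heavier.
by case: (m < w); rewrite ?andbF //= andbA.
Qed.

Lemma path_heavy_step m a p :
  path (heavy_step m) a p = path (inc_step X) a p && path (heavier m) a p.
Proof.
by elim: p a => //= y p IHp a; rewrite IHp /heavy_step andbACA.
Qed.

(** The length bound [#|V|] in [iconn] loses no path, since vertices are distinct; nonnegativity of
    the weight handles the default 0 of the maximum. *)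
Lemma strong_pairP a b : 0 <= pweight X (a, [set a; b]) ->
  reflect (forall p, inc_path X a b p ->
             inc_strength X a b p <= pweight X (a, [set a; b]))
          (iconn X a b <= pweight X (a, [set a; b])).
Proof.
move=> w_ge0; apply: (iffP idP) => [strong p p_inc|strong].
  have size_p : (size p <= #|V|)%N.
    have /and5P[_ _ /andP[_ uniq_p] _ _] := p_inc.
    by rewrite cardE; apply: uniq_leq_size => // x; rewrite mem_enum.
  apply: le_trans strong.
  exact: (le_bigmax_cond _ (j := Bseq size_p)
            (fun q : #|V|.-bseq V => inc_strength X a b q)).
by apply: bigmax_le => // p; apply: strong.
Qed.

(** Here [p] may repeat vertices, as the projection of a path to a factor can. The strict inequality
    makes the closing pair (b, ab) heavy as well. *)
Lemma heavy_walk_not_strong a b p :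
  is_fig X -> (a, [set a; b]) \in pairs X -> (b, [set a; b]) \in pairs X ->
  pweight X (a, [set a; b]) < pweight X (b, [set a; b]) ->
  path (heavy_step (pweight X (a, [set a; b]))) a p -> last a p = b ->
  ~ strong_pair X a b.
Proof.
move=> figX pa pb lt_ab heavy_p last_p.
have [_ [_ [pairP [_ [_ [pwP _]]]]]] := figX.
have [ab_edge _] := pairP _ _ pa.
have w_ge0 : 0 <= pweight X (a, [set a; b]) by case/andP: (pwP _ pa) => /ltW.
move=> /(strong_pairP w_ge0) strong.
(* Loop removal gives a path for the same relation, so every remaining step is still heavy. *)
case/shortenP: heavy_p last_p => q heavy_q uniq_q _ last_q.
have [step_q heavier_q] := andP (etrans (esym (path_heavy_step _ _ _)) heavy_q).
suff q_inc : inc_path X a b q.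
  by move: (strong q q_inc); rewrite leNgt lt_inc_strength lt_ab heavier_q.
rewrite /inc_path step_q uniq_q last_q eqxx ab_edge pb !andbT.
(* Only the length bound is left: an empty [q] would give a = b, though ab is an edge, and a single
   step would make (a, ab) heavier than itself. *)
case: q last_q heavier_q {heavy_q uniq_q step_q} => [|c [|//]] /=.
  by move=> eq_ab; move: (fig_edge_neq figX ab_edge); rewrite eq_ab eqxx.
by move=> ->; rewrite /heavier ltxx.
Qed.

End Strength.

Section Tensor.
Variables (R : realType) (V1 V2 : finType).
Variables (X1 : fig_data R V1) (X2 : fig_data R V2).
Implicit Types u v : (V1 * V2)%type.

(** An edge fixes its endpoints up to order; a swap exchanges both coordinates at once and preserves
    the condition. *)
Lemma tensor_edge u v : ([set u; v] \in edges (tensor X1 X2)) =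
  ([set u.1; v.1] \in edges X1) && ([set u.2; v.2] \in edges X2).
Proof.
apply/imset2P/idP => [[u' v' _]|uv]; last by exists u v; rewrite ?inE.
rewrite !inE /= => uv /set2_inj[[-> ->]|[-> ->]] //.
by rewrite [[set v'.1; _]]setUC [[set v'.2; _]]setUC.
Qed.

Lemma tensor_pair u v : ((u, [set u; v]) \in pairs (tensor X1 X2)) =
  [&& (u.1, [set u.1; v.1]) \in pairs X1, (v.1, [set u.1; v.1]) \in pairs X1,
      (u.2, [set u.2; v.2]) \in pairs X2 & (v.2, [set u.2; v.2]) \in pairs X2].
Proof.
apply/imset2P/idP => [[u' v' _]|uv]; last by exists u v; rewrite ?inE.
by rewrite !inE /= => uv [-> /set2_injr ->].
Qed.

Lemma tensor_pairE w e : (w, e) \in pairs (tensor X1 X2) ->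
  exists v, e = [set w; v].
Proof. by case/imset2P=> u v _ _ [-> ->]; exists v. Qed.

(** Keeping [w] separate from [u] and [v] lets one formula serve the pairs at both endpoints. *)
Lemma tensor_pweight w u v : pweight (tensor X1 X2) (w, [set u; v]) =
  Num.min (pweight X1 (w.1, [set u.1; v.1])) (pweight X2 (w.2, [set u.2; v.2])).
Proof. by rewrite /= !imset_set2. Qed.

Lemma tensor_eweight u v : eweight (tensor X1 X2) [set u; v] =
  Num.min (eweight X1 [set u.1; v.1]) (eweight X2 [set u.2; v.2]).
Proof. by rewrite /= !imset_set2. Qed.

(** A minimum exceeds [m] exactly when both terms do, so one threshold works in both factors. *)
Lemma heavy_step_tensor m u v : heavy_step (tensor X1 X2) m u v ->
  heavy_step X1 m u.1 v.1 /\ heavy_step X2 m u.2 v.2.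
Proof.
rewrite /heavy_step /inc_step /heavier !tensor_pweight !lt_min tensor_edge.
rewrite tensor_pair => /andP[/and3P[/andP[-> ->] /and4P[-> -> -> ->] _]].
by case/andP=> /andP[-> ->] /andP[-> ->].
Qed.

Lemma tensor_fig : is_fig X1 -> is_fig X2 -> is_fig (tensor X1 X2).
Proof.
move=> fig1 fig2.
have [n1 [_ [pe1 [v1 [e1 [p1 [ve1 pw1]]]]]]] := fig1.
have [n2 [_ [pe2 [v2 [e2 [p2 [ve2 pw2]]]]]]] := fig2.
have min01 (x y : R) : 0 < x <= 1 -> 0 < y <= 1 -> 0 < Num.min x y <= 1.
  by case/andP=> x0 x1 /andP[y0 _]; rewrite lt_min x0 y0 ge_min x1.
have edgeE e : e \in edges (tensor X1 X2) -> exists u v, e = [set u; v].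
  by case/imset2P=> u v _ _ ->; exists u, v.
split; first by rewrite card_prod muln_gt0 n1.
split=> [e eE|].
  have [u [v euv]] := edgeE e eE; exists u, v; split=> //.
  (* A loop at [u] would project to a loop of [X1]. *)
  move: eE; rewrite euv tensor_edge => /andP[/(fig_edge_neq fig1) neq _].
  by apply: contraNneq neq => ->.
split=> [w e eP|].
  have [v ev] := tensor_pairE eP; move: eP.
  rewrite ev tensor_pair tensor_edge set21.
  by case/and4P=> /pe1[-> _] _ /pe2[-> _] _.
split=> [u|]; first exact: min01.
split=> [e eE|].
  have [u [v euv]] := edgeE e eE; move: eE.
  rewrite euv tensor_edge tensor_eweight => /andP[uv1 uv2].
  by apply: min01; [apply: e1|apply: e2].
split=> [[w e] eP|].
  have [v ev] := tensor_pairE eP; move: eP.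
  rewrite ev tensor_pair tensor_pweight => /and4P[wv1 _ wv2 _].
  by apply: min01; [apply: p1|apply: p2].
split=> [u v|w e eP].
  rewrite tensor_edge tensor_eweight => /andP[/ve1 + /ve2].
  rewrite /= !le_min !ge_min => /andP[-> ->] /andP[-> ->].
  by rewrite !orbT.
have [v ev] := tensor_pairE eP; move: eP.
rewrite ev tensor_pair tensor_pweight tensor_eweight.
case/and4P=> /pw1 + _ /pw2 + _.
by rewrite /= !le_min !ge_min => /andP[-> ->] /andP[-> ->]; rewrite !orbT.
Qed.

End Tensor.

Theorem theorem5p5 (R : realType) (V1 V2 : finType)
    (X1 : fig_data R V1) (X2 : fig_data R V2) :
  is_sfig X1 -> is_sfig X2 -> is_sfig (tensor X1 X2).
Proof.
move=> [fig1 strong1] [fig2 strong2].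
have figT := tensor_fig fig1 fig2; split=> // a b ab.
have [_ [_ [_ [_ [_ [pwT _]]]]]] := figT.
have w_ge0 : 0 <= pweight (tensor X1 X2) (a, [set a; b]).
  by case/andP: (pwT _ ab) => /ltW.
apply/(strong_pairP w_ge0) => p p_inc; rewrite leNgt lt_inc_strength.
apply/negP => /andP[].
(* The closing pair at [b] is heavy in both factors, before it is known which factor attains the
   weight at [a]. *)
rewrite (tensor_pweight _ _ b) lt_min => /andP[lt1 lt2] heavier_p.
have /and5P[_ step_p _ /eqP last_p _] := p_inc.
have heavy_p : path (heavy_step (tensor X1 X2)
    (pweight (tensor X1 X2) (a, [set a; b]))) a p.
  by rewrite path_heavy_step step_p.
move: ab; rewrite tensor_pair => /and4P[a1 b1 a2 b2].
(* Splitting the minimum turns the threshold into the weight of the projected pair in one factor, as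
   [heavy_walk_not_strong] requires; a tie goes to [X2]. *)
move: lt1 lt2 heavy_p; rewrite tensor_pweight minElt.
case: ifP => _ lt1 lt2 heavy_p.
- apply: (heavy_walk_not_strong (p := map fst p) fig1 a1 b1 lt1 _ _
           (strong1 _ _ a1)).
    apply: homo_path heavy_p => u v /heavy_step_tensor[]//.
  by rewrite last_map last_p.
- apply: (heavy_walk_not_strong (p := map snd p) fig2 a2 b2 lt2 _ _
           (strong2 _ _ a2)).
    apply: homo_path heavy_p => u v /heavy_step_tensor[]//.
  by rewrite last_map last_p.
Qed.
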